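(* Let $d\ge1$, $p>1$, $s\in(0,1)$, and $\alpha_1,\alpha_2\in\mathbb{R}$ with $\alpha=\alpha_1+\alpha_2$, $\alpha_1p,\alpha_2p\in(-d,sp)$, $0\le\alpha p<sp$ and $sp-\alpha p<d$. Let $\mathcal{C}_\alpha>0$ be the weighted fractional Sobolev constant described in the context. Then for every $u\in W^{s,p,\alpha}(\mathbb{R}^d)$ with $\int_{\mathbb{R}^d}|u(x)|^pdx=1$, \[ \int_{\mathbb{R}^d}|u(x)|^p\log|u(x)|\,dx\le\frac{d}{(s-\alpha)p^2}\log\left(\mathcal{C}_\alpha\int_{\mathbb{R}^d}\int_{\mathbb{R}^d}\frac{|u(x)-u(y)|^p}{|x-y|^{d+sp}}|x|^{\alpha_1p}|y|^{\alpha_2p}\,dx\,dy\right). \]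
   Context: The weighted Gagliardo seminorm is $[u]_{W^{s,p,\alpha}(\mathbb{R}^d)}^p=\int_{\mathbb{R}^d}\int_{\mathbb{R}^d}\frac{|u(x)-u(y)|^p}{|x-y|^{d+sp}}|x|^{\alpha_1p}|y|^{\alpha_2p}dx\,dy$, and $W^{s,p,\alpha}(\mathbb{R}^d)$ is the closure of $C^1_c(\mathbb{R}^d)$ with respect to the norm $(\|u\|_{L^p(\mathbb{R}^d)}^p+[u]_{W^{s,p,\alpha}(\mathbb{R}^d)}^p)^{1/p}$. $\mathcal{C}_\alpha=\mathcal{C}_\alpha(d,p,s,\alpha_1,\alpha_2)>0$ is a constant such that, with $p^*_{s,\alpha}=\frac{dp}{d-sp+\alpha p}$, the weighted fractional Sobolev inequality $\|u\|_{L^{p^*_{s,\alpha}}(\mathbb{R}^d)}\le\mathcal{C}_\alpha^{1/p}[u]_{W^{s,p,\alpha}(\mathbb{R}^d)}$ holds for all $u\in W^{s,p,\alpha}(\mathbb{R}^d)$ (such a constant exists under the stated hypotheses by a fractional Caffarelli–Kohn–Nirenberg inequality of Nguyen and Squassina). *)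

(* Defs.v *)
From HB Require Import structures.
From mathcomp Require Import all_boot all_order all_algebra.
From mathcomp Require Import all_classical all_reals all_analysis.
Set Implicit Arguments. Unset Strict Implicit. Unset Printing Implicit Defensive.
Import Order.TTheory GRing.Theory Num.Theory.
Import numFieldNormedType.Exports.
Local Open Scope classical_set_scope.
Local Open Scope ring_scope.

(* R^d is represented by row vectors 'rV[R]_d.  We equip it with the product
   (= Borel) sigma-algebra generated by the coordinate projections. *)
Definition rV_display : measure_display -> measure_display.
Proof. exact. Qed.

Section measurable_rV.
Context {dR} {T : sigmaRingType dR}.
Variable n : nat.
Let coord : 'I_n -> 'rV[T]_n -> T := fun i x => x ord0 i.
Let rV_set0 : g_sigma_preimage coord set0.
Proof. exact: sigma_algebra0. Qed.
Let rV_setC A : g_sigma_preimage coord A -> g_sigma_preimage coord (~` A).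
Proof. exact: sigma_algebraC. Qed.
Let rV_bigcup (F : _^nat) : (forall i, g_sigma_preimage coord (F i)) ->
  g_sigma_preimage coord (\bigcup_i (F i)).
Proof. exact: sigma_algebra_bigcup. Qed.
HB.instance Definition _ := @isMeasurable.Build (rV_display dR)
  'rV[T]_n (g_sigma_preimage coord) rV_set0 rV_setC rV_bigcup.
End measurable_rV.

Section defs.
Context {R : realType} {d : nat}.

Definition enorm (x : 'rV[R]_d) : R := Num.sqrt (\sum_(i < d) x ord0 i ^+ 2).

(* mu is Lebesgue measure on R^d: it gives every closed box its volume
   (this characterizes Lebesgue measure on the Borel sets). *)
Definition is_lebesgue_Rd (mu : {measure set 'rV[R]_d -> \bar R}) : Prop :=
  forall a b : 'I_d -> R, (forall i, a i <= b i) ->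
    mu [set x | forall i, a i <= x ord0 i <= b i] = (\prod_(i < d) (b i - a i))%:E.

Definition C1c (f : 'rV[R]_d -> R) : Prop :=
  (forall x, differentiable f x) /\
  (forall v : 'rV[R]_d, continuous (fun x => 'd f x v)) /\
  (exists r : R, forall x, r < enorm x -> f x = 0).

Definition gagliardo (mu : {measure set 'rV[R]_d -> \bar R}) (s p a1 a2 : R)
  (u : 'rV[R]_d -> R) : \bar R :=
  (\int[mu]_x \int[mu]_y
     ((`|u x - u y| `^ p / enorm (x - y) `^ (d%:R + s * p))
        * enorm x `^ (a1 * p) * enorm y `^ (a2 * p))%:E)%E.

Definition Lp_pow (mu : {measure set 'rV[R]_d -> \bar R}) (p : R)
  (u : 'rV[R]_d -> R) : \bar R := (\int[mu]_x (`|u x| `^ p)%:E)%E.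

(* W^{s,p,alpha}(R^d): closure of C^1_c for the norm
   (||u||_p^p + [u]^p)^(1/p) *)
Definition Wspa (mu : {measure set 'rV[R]_d -> \bar R}) (s p a1 a2 : R)
  (u : 'rV[R]_d -> R) : Prop :=
  measurable_fun setT u /\
  exists phi : nat -> 'rV[R]_d -> R, (forall n, C1c (phi n)) /\
    ((fun n => Lp_pow mu p (fun x => u x - phi n x)%R
        + gagliardo mu s p a1 a2 (fun x => u x - phi n x)%R)%E
       @ \oo --> 0%E).

End defs.

(* Main.v *)
(** Jensen's inequality for [ln] against the probability [|u|^p dx], with
    [q = dp/(d - sp + alpha p)], gives
    [int |u|^p ln |u| <= (q - p)^-1 ln (int |u|^q)], and the Sobolev inequality
    bounds the right-hand side by [q/(p(q - p)) ln (C [u]^p)], where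
    [q/(p(q - p)) = d/((s - alpha)p^2)].

    Since [fine +oo = 0] and [ln 0 = 0], the bound is only meaningful once
    [[u]] is known to be finite on W^{s,p,alpha}.  By density it is enough to
    treat [C^1_c] functions.  If f vanishes outside the ball of radius r, then
    near the diagonal (x, y in the ball of radius 2r) the Lipschitz bound leaves
    the locally integrable kernel [|x - y|^(-d + (1 - s)p)]; as [alpha >= 0], one
    of the two weights is bounded there and the other one is locally integrable.
    Off the diagonal, [|x - y| >= |y|/2] and [|y|^(alpha_2 p - d - sp)] is
    integrable at infinity.  Integrals of powers of [|x|] are estimated over
    dyadic shells, which only uses the volume of boxes. *)

Require Import Defs.
From HB Require Import structures.
From mathcomp Require Import all_boot all_order all_algebra.
From mathcomp Require Import all_classical all_reals all_analysis.
From mathcomp Require Import measurable_realfun ring lra.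
Set Implicit Arguments.
Unset Strict Implicit.
Import Order.TTheory GRing.Theory Num.Theory.
Import numFieldNormedType.Exports.
Local Open Scope classical_set_scope.
Local Open Scope ring_scope.

(** * Jensen's inequality for the logarithm *)

Section entropy.
Context {dT : measure_display} {T : measurableType dT} {R : realType}.
Variable mu : {measure set T -> \bar R}.

(** Positive parts grow from [f] to [g] and negative parts shrink. This serves the entropy
    integrand, of which only measurability is known. *)
Lemma le_integral_measurable (f g : T -> \bar R) :
  measurable_fun setT f -> measurable_fun setT g ->
  (forall x, (f x <= g x)%E) -> (\int[mu]_x f x <= \int[mu]_x g x)%E.
Proof.
move=> mf mg fg; rewrite integralE [leRHS]integralE leeB//.
- apply: ge0_le_integral => //; [exact: measurable_funepos..|].
  by move=> x _; apply: (@funepos_le _ _ setT) => //; rewrite inE.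
- apply: ge0_le_integral => //; [exact: measurable_funeneg..|].
  by move=> x _; apply: (@funeneg_le _ _ setT) => //; rewrite inE.
Qed.

(** For X = t^(q - p), ln t equals (q - p)^-1 ln X, and ln X lies below the tangent line of ln at
    [A]; multiplying by t^p gives the bound. *)
Lemma entropy_pointwise (p q A t : R) : 0 < p -> p < q -> 0 < A -> 0 <= t ->
  t `^ p * ln t <=
  (q - p)^-1 / A * t `^ q + (q - p)^-1 * (ln A - 1) * t `^ p.
Proof.
move=> p0 pq A0; rewrite le_eqVlt => /predU1P[<-|t0].
  (* At t = 0 both sides vanish, since the exponents [p] and [q] are nonzero. *)
  rewrite !powR0; [|by rewrite gt_eqF//; lra..].
  by rewrite !(mulr0, mul0r) addr0.
have tp0 : 0 < t `^ p by exact: powR_gt0.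
have qp0 : 0 < q - p by lra.
have -> : t `^ q = t `^ p * t `^ (q - p).
  by rewrite -powRD ?subrKC// gt_eqF//; lra.
have X0 : 0 < t `^ (q - p) by exact: powR_gt0.
have -> : ln t = (q - p)^-1 * ln (t `^ (q - p)) by rewrite ln_powR mulKf// gt_eqF.
move: (t `^ (q - p)) X0 => X X0.
have h : ln X <= X / A - 1 + ln A.
  have := @le_ln1Dx R (X / A - 1); rewrite subrKC ln_div ?posrE//.
  have XA : 0 < X / A by rewrite divr_gt0.
  by move=> /(_ ltac:(lra)); lra.
rewrite [leRHS](_ : _ = t `^ p * ((q - p)^-1 * (X / A - 1 + ln A))); last by ring.
by rewrite ler_pM2l// ler_pM2l// invr_gt0.
Qed.

(* Jensen's inequality for ln against the probability |f|^p dmu, by integrating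
   the tangent line of ln at A. *)
Lemma entropy_le_ln (f : T -> R) (p q A : R) : measurable_fun setT f ->
  0 < p -> p < q -> 0 < A ->
  (\int[mu]_x (`|f x| `^ p)%:E = 1)%E ->
  (\int[mu]_x (`|f x| `^ q)%:E = A%:E)%E ->
  (\int[mu]_x (`|f x| `^ p * ln `|f x|)%:E <= ((q - p)^-1 * ln A)%:E)%E.
Proof.
move=> mf p0 pq A0 Ip Iq.
have mnf : measurable_fun setT (fun x => `|f x|) by exact: measurableT_comp.
have mpow r : measurable_fun setT (fun x => (`|f x| `^ r)%:E).
  by apply/measurable_EFinP; exact: (measurableT_comp (measurable_powR _)).
have intg r B : (\int[mu]_x (`|f x| `^ r)%:E = B%:E)%E ->
    mu.-integrable setT (fun x => (`|f x| `^ r)%:E).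
  move=> e; apply/integrableP; split=> //.
  under eq_integral do rewrite gee0_abs ?lee_fin ?powR_ge0//.
  by rewrite e ltry.
set a := (q - p)^-1 / A; set b := (q - p)^-1 * (ln A - 1).
have ip := intg p 1 Ip; have iq := intg q A Iq.
apply: (@le_trans _ _
    (\int[mu]_x (a%:E * (`|f x| `^ q)%:E + b%:E * (`|f x| `^ p)%:E))%E).
  apply: le_integral_measurable.
  - apply/measurable_EFinP; apply: measurable_funM.
      exact: (measurableT_comp (measurable_powR _)).
    exact: (measurableT_comp (@measurable_ln R)).
  - by apply: emeasurable_funD; apply: measurable_funeM.
  - by move=> x; rewrite -!EFinM -EFinD lee_fin entropy_pointwise.
rewrite integralD//; [|exact: integrableZl..].
rewrite !integralZl// Ip Iq -!EFinM -EFinD lee_fin /a /b.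
(* The first term contributes [(q - p)^-1], which cancels the [- 1] inside [b]. *)
rewrite mulr1 divfK ?gt_eqF//.
by rewrite mulrBr mulr1 subrKC.
Qed.

End entropy.

(** * The Euclidean norm on row vectors *)

Section euclidean_norm.
Context {R : realType} {d : nat}.
Implicit Types x y : 'rV[R]_d.

Lemma enorm_ge0 x : 0 <= enorm x. Proof. exact: sqrtr_ge0. Qed.

Let sumsq_ge0 x : 0 <= \sum_(i < d) x ord0 i ^+ 2.
Proof. by apply: sumr_ge0 => i _; exact: sqr_ge0. Qed.

Lemma enorm_sqr x : enorm x ^+ 2 = \sum_(i < d) x ord0 i ^+ 2.
Proof. by rewrite sqr_sqrtr. Qed.

Lemma enormN x : enorm (- x) = enorm x.
Proof.
by congr Num.sqrt; apply: eq_bigr => i _; rewrite mxE sqrrN.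
Qed.

Lemma enormB x y : enorm (x - y) = enorm (y - x).
Proof. by rewrite -enormN opprB. Qed.

Lemma coord_le_enorm x i : `|x ord0 i| <= enorm x.
Proof.
rewrite -(ler_pXn2r (n := 2)) ?nnegrE ?enorm_ge0// enorm_sqr real_normK ?num_real//.
by rewrite (bigD1 i)//= lerDl; apply: sumr_ge0 => j _; exact: sqr_ge0.
Qed.

Lemma enorm0_eq0 x : enorm x = 0 -> x = 0.
Proof.
move=> x0; apply/matrixP => i j; rewrite ord1 mxE.
by apply/eqP; rewrite -normr_le0 -x0 coord_le_enorm.
Qed.

(** The ambient norm of row vectors is the max norm, in which compactness is used below. *)
Lemma norm_le_enorm x : `|x| <= enorm x.
Proof.
rewrite /Num.norm/= mx_normrE; apply/bigmax_leP; split; first exact: enorm_ge0.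
by case=> i j _ /=; rewrite ord1; exact: coord_le_enorm.
Qed.

Lemma cauchy_schwarz x y :
  \sum_(i < d) x ord0 i * y ord0 i <= enorm x * enorm y.
Proof.
have [y0|yN0] := eqVneq (enorm y) 0.
  rewrite (enorm0_eq0 y0) big1 ?y0 ?mulr_ge0 ?enorm_ge0// => i _.
  by rewrite mxE mulr0.
set S := \sum_(i < d) _; apply: (le_trans (ler_norm S)).
rewrite -(ler_pXn2r (n := 2)) ?nnegrE ?mulr_ge0 ?enorm_ge0//.
rewrite real_normK ?num_real//.
have B0 : 0 < enorm y ^+ 2 by rewrite exprn_gt0// lt_def yN0 enorm_ge0.
(* The squared length of |y|^2 x - S y expands to |y|^2 (|x|^2 |y|^2 - S^2). *)
have : 0 <= \sum_(i < d) (enorm y ^+ 2 * x ord0 i - S * y ord0 i) ^+ 2.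
  by apply: sumr_ge0 => i _; exact: sqr_ge0.
rewrite (eq_bigr (fun i => (enorm y ^+ 2) ^+ 2 * x ord0 i ^+ 2 +
    (- (2 * enorm y ^+ 2 * S) * (x ord0 i * y ord0 i) +
    S ^+ 2 * y ord0 i ^+ 2))); last by move=> i _; ring.
rewrite !big_split/= -!mulr_sumr -!enorm_sqr -/S.
rewrite [leRHS](_ : _ = enorm y ^+ 2 * ((enorm x * enorm y) ^+ 2 - S ^+ 2));
  last by ring.
by rewrite pmulr_rge0// subr_ge0.
Qed.

Lemma ler_enormD x y : enorm (x + y) <= enorm x + enorm y.
Proof.
rewrite -(ler_pXn2r (n := 2)) ?nnegrE ?addr_ge0 ?enorm_ge0//.
rewrite enorm_sqr (eq_bigr (fun i => x ord0 i ^+ 2 +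
    (2 * (x ord0 i * y ord0 i) + y ord0 i ^+ 2))); last first.
  by move=> i _; rewrite mxE; ring.
rewrite !big_split/= -!mulr_sumr -!enorm_sqr.
by have := cauchy_schwarz x y; lra.
Qed.

Lemma ler_enormB x y : enorm (x - y) <= enorm x + enorm y.
Proof. by rewrite -(enormN y) ler_enormD. Qed.

Lemma measurable_coord i : measurable_fun setT (fun x => x ord0 i).
Proof.
move=> _ Y mY; rewrite setTI; apply: sub_sigma_algebra => /=.
rewrite -bigcup_seq/=; exists i => /=; first by rewrite mem_index_enum.
by exists Y => //; rewrite setTI.
Qed.

(** A general map [f] allows both projections and the difference x - y on the product space to be
    treated alike. *)
Lemma measurable_enorm {dT} {T : measurableType dT} (f : T -> 'rV[R]_d) :
  (forall i, measurable_fun setT (fun t => f t ord0 i)) ->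
  measurable_fun setT (fun t => enorm (f t)).
Proof.
move=> mf.
under eq_fun do rewrite /enorm -powR12_sqrt//.
apply: (measurableT_comp (measurable_powR _)).
by apply: measurable_sum => i; exact: measurable_funX.
Qed.

End euclidean_norm.

(** * Cubes, open sets and shell sums for Lebesgue measure *)

Section lebesgue_Rd.
Context {R : realType} {d : nat}.
Implicit Types x y : 'rV[R]_d.

(** Cubes replace Euclidean balls because [is_lebesgue_Rd] prescribes their volume directly. *)
Definition box (c : 'rV[R]_d) (t : R) : set 'rV[R]_d :=
  [set x | forall i, c ord0 i - t <= x ord0 i <= c ord0 i + t].

Lemma measurable_box c t : measurable (box c t).
Proof.
rewrite (_ : box c t = \bigcap_(i in [set: 'I_d])
    ((fun x => x ord0 i) @^-1` `[c ord0 i - t, c ord0 i + t]%classic)).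
  apply: fin_bigcap_measurable => [|i _]; first exact: finite_finset.
  by rewrite -[X in measurable X]setTI; exact: measurable_coord.
apply/seteqP; split=> x /= h i; first by move=> _ /=; rewrite in_itv/= h.
by have := h i Logic.I; rewrite /= in_itv.
Qed.

Lemma enorm_le_box c x t : enorm (c - x) <= t -> box c t x.
Proof.
move=> h i; have := le_trans (coord_le_enorm (c - x) i) h.
by rewrite !mxE ler_norml => /andP[? ?]; lra.
Qed.

(** [A] is the union of the countably many cubes with rational centre and half-side 1/(n+1) that it
    contains. This links the topology to the sigma-algebra, which is generated by coordinates. *)
Lemma open_rV_measurable (A : set 'rV[R]_d) : open A -> measurable A.
Proof.
move=> oA.
pose q2r (q : 'rV[rat]_d) : 'rV[R]_d := map_mx ratr q.
pose F (z : 'rV[rat]_d * nat) : set 'rV[R]_d :=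
  let B := box (q2r z.1) z.2.+1%:R^-1 in
  if `[< B `<=` A >] then B else set0.
rewrite (_ : A = \bigcup_z F z).
  apply: countable_bigcupT_measurable; first exact: countableP.
  by move=> z; rewrite /F/=; case: ifP => // _; exact: measurable_box.
apply/seteqP; split=> [x Ax|x [z _]]; last first.
  by rewrite /F/=; case: ifPn => // /asboolP; exact.
have /nbhs_ballP[e /= e0 xeA] : nbhs x A by exact: open_nbhs_nbhs.
(* The centre is within 1/(n+1) of x, so the cube stays within 2/(n+1) < e of x in the max norm. *)
have [n _ ne] : exists2 n, True & n.+1%:R^-1 < e / 2.
  exists (Num.truncn ((e / 2)^-1)) => //.
  by rewrite invf_plt ?posrE ?divr_gt0// truncnS_gt.
have /choice[q qP] : forall i, exists q : rat,
    x ord0 i - n.+1%:R^-1 < ratr q < x ord0 i + n.+1%:R^-1.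
  move=> i; have n0 : 0 < n.+1%:R^-1 :> R by rewrite invr_gt0.
  have [q] : exists q : rat,
      ratr q \in `](x ord0 i - n.+1%:R^-1), (x ord0 i + n.+1%:R^-1)[.
    apply: rat_in_itvoo.
    by rewrite (@lt_trans _ _ (x ord0 i))// ?ltrDl// ltrBlDr ltrDl.
  by rewrite in_itv/= => ?; exists q.
exists (\row_i q i, n) => //; rewrite /F/=.
have -> : `[< box (q2r (\row_i q i)) n.+1%:R^-1 `<=` A >].
  apply/asboolP => y yq; apply: xeA; split=> // i j; rewrite !ord1.
  have := yq j; have := qP j; rewrite !mxE /ball/= ltr_norml.
  move: (n.+1%:R^-1) ne => e' ? /andP[? ?] /andP[? ?].
  by apply/andP; split; lra.
move=> i; have := qP i; rewrite !mxE.
by move: (n.+1%:R^-1) => e' /andP[? ?]; apply/andP; split; lra.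
Qed.

Lemma continuous_rV_measurable (f : 'rV[R]_d -> R) :
  continuous f -> measurable_fun setT f.
Proof.
move=> /continuousP cf; apply: (measurability _ (RGenOpens.measurableE R)).
move=> _ [_ [a [b ->] <-]]; rewrite setTI.
by apply: open_rV_measurable; exact/cf/interval_open.
Qed.

Variable mu : {measure set 'rV[R]_d -> \bar R}.
Hypothesis mu_leb : is_lebesgue_Rd mu.

Lemma mu_box c t : 0 <= t -> mu (box c t) = ((2 * t) ^+ d)%:E.
Proof.
move=> t0; rewrite /box mu_leb; last by move=> i; lra.
congr EFin; rewrite (eq_bigr (fun=> 2 * t)); last by move=> i _; ring.
by rewrite prodr_const card_ord.
Qed.

Lemma lebesgue_sigma_finite : sigma_finite setT mu.
Proof.
exists (fun n => box 0 n%:R).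
  apply/seteqP; split=> // x _; exists (Num.truncn (enorm x)).+1 => //.
  apply: enorm_le_box; rewrite sub0r enormN ltW// truncnS_gt//.
move=> n; split; first exact: measurable_box.
by rewrite mu_box// ltry.
Qed.

(** The covering hypothesis gives f <= sum_k b_k 1_(box c t_k), which is integrated term by term.
    Using full cubes instead of shells costs only a constant for geometric radii. *)
Lemma integral_shells (c : 'rV[R]_d) (f : 'rV[R]_d -> R) (b t : nat -> R) :
  measurable_fun setT f ->
  (forall x, 0 <= f x) -> (forall k, 0 <= b k) -> (forall k, 0 <= t k) ->
  (forall x, 0 < f x -> exists k, f x <= b k /\ enorm (c - x) <= t k) ->
  (\int[mu]_x (f x)%:E <= \sum_(k <oo) (b k * (2 * t k) ^+ d)%:E)%E.
Proof.
move=> mf f0 b0 t0 cover.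
pose g k (x : 'rV[R]_d) : \bar R := ((b k)%:E * (\1_(box c (t k)) x)%:E)%E.
have mind k : measurable_fun setT (fun x => (\1_(box c (t k)) x : R)%:E).
  by apply/measurable_EFinP; apply: measurable_indic; exact: measurable_box.
have mg k : measurable_fun setT (g k) by exact: measurable_funeM.
have g0 k x : (0 <= g k x)%E by rewrite mule_ge0// lee_fin.
apply: (@le_trans _ _ (\int[mu]_x \sum_(k <oo) g k x)%E).
  apply: ge0_le_integral => //.
  - by move=> x _; rewrite lee_fin.
  - exact/measurable_EFinP.
  - exact: ge0_emeasurable_sum.
  move=> x _; have [fx0|fx0] := leP (f x) 0.
    by rewrite (le_trans (y := 0%E)) ?lee_fin// nneseries_ge0.
  have [k [fb xt]] := cover x fx0.
  rewrite (@nneseriesD1 _ (g ^~ x) k)// (le_trans (y := g k x))//; last first.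
    by rewrite leeDl// nneseries_ge0.
  by rewrite /g indicE mem_set ?mule1 ?lee_fin//; exact: enorm_le_box.
rewrite integral_nneseries//; apply: lee_nneseries => k *.
  by apply: integral_ge0 => x _.
rewrite ge0_integralZl//.
  by rewrite integral_indic ?setIT ?mu_box//; exact: measurable_box.
by rewrite lee_fin.
Qed.

End lebesgue_Rd.

(** * Integrals of powers of |x| near a point and at infinity *)

Section power_weights.
Context {R : realType} {d : nat}.
Implicit Types x y : 'rV[R]_d.

Lemma le0_ler_powR (c a b : R) : c <= 0 -> 0 < a -> a <= b -> b `^ c <= a `^ c.
Proof.
move=> c0 a0 ab; have b0 : 0 < b by lra.
rewrite -[c]opprK (powRN b) (powRN a) lef_pV2 ?posrE ?powR_gt0//.
by rewrite ge0_ler_powR ?nnegrE//; lra.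
Qed.

Lemma powRV (a c : R) : 0 <= a -> a^-1 `^ c = a `^ (- c).
Proof. by move=> a0; rewrite -powR_inv1// -powRrM mulN1r. Qed.

Lemma powR_lt1 (a c : R) : 1 < a -> c < 0 -> a `^ c < 1.
Proof.
move=> a1 c0; rewrite /powR gt_eqF ?(lt_trans _ a1)// expR_lt1.
by rewrite nmulr_rlt0// ln_gt0.
Qed.

(** The maximum is at [tau] for c >= 0 and at [tau / 2] for c <= 0; the constant covers both
    signs. *)
Lemma powR_half_annulus (c t tau : R) : 0 < tau -> tau / 2 <= t <= tau ->
  t `^ c <= (1 + 2 `^ (- c)) * tau `^ c.
Proof.
move=> tau0 /andP[t1 t2]; have t0 : 0 < t by lra.
rewrite mulrDl mul1r; have [c0|/ltW c0] := leP 0 c.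
  rewrite (le_trans (y := tau `^ c)) ?ge0_ler_powR ?nnegrE ?(ltW t0) ?(ltW tau0)//.
  by rewrite lerDl mulr_ge0// powR_ge0.
apply: le_trans (le0_ler_powR c0 _ t1) _; first by lra.
rewrite powRM ?(ltW tau0)//.
by rewrite powRV// mulrC lerDr powR_ge0.
Qed.

Lemma exists_pow2_gt (y : R) : exists n : nat, y < 2 ^+ n.
Proof.
exists (Num.truncn y).+1; apply: (lt_trans (truncnS_gt y)).
by rewrite -natrX ltr_nat ltn_expl.
Qed.

(** The least k satisfying the lower bound also satisfies the upper one: otherwise k - 1 would
    do. *)
Lemma dyadic_near (rho t : R) : 0 < t -> t <= rho ->
  exists k : nat, rho * 2^-1 ^+ k / 2 <= t <= rho * 2^-1 ^+ k.
Proof.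
move=> t0 trho.
have ex : exists k : nat, rho * 2^-1 ^+ k / 2 <= t.
  have [n hn] := exists_pow2_gt (rho / t); exists n.
  have : rho < t * 2 ^+ n by rewrite -ltr_pdivrMl// mulrC.
  move=> h; rewrite (le_trans (y := rho * 2^-1 ^+ n))//.
    by rewrite ler_pdivrMr// ler_peMr ?mulr_ge0 ?exprn_ge0//; lra.
  by rewrite exprVn ler_pdivrMr ?exprn_gt0// ltW.
case: (ex_minnP ex) => k hk kmin; exists k; rewrite hk/=.
case: k hk kmin => [|k] hk kmin; first by rewrite expr0 mulr1.
rewrite leNgt; apply/negP => hlt.
have /kmin : rho * 2^-1 ^+ k / 2 <= t by move: hlt; rewrite exprSr; lra.
by rewrite ltnn.
Qed.

(** Here k is least for the upper bound. Radii start at [rho * 2], so that the shell k = 0 begins at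
    [rho]. *)
Lemma dyadic_far (rho t : R) : 0 < rho -> rho < t ->
  exists k : nat, rho * 2 * 2 ^+ k / 2 <= t <= rho * 2 * 2 ^+ k.
Proof.
move=> rho0 rhot.
have ex : exists k : nat, t <= rho * 2 * 2 ^+ k.
  have [n hn] := exists_pow2_gt (t / rho); exists n.
  have h : t < rho * 2 ^+ n by rewrite -ltr_pdivrMl// mulrC.
  rewrite (le_trans (ltW h))// -mulrA ler_pM2l// ler_peMl ?exprn_ge0//; lra.
case: (ex_minnP ex) => k hk kmin; exists k; rewrite hk andbT.
case: k hk kmin => [|k] hk kmin; first by rewrite expr0; lra.
rewrite leNgt; apply/negP => hlt.
have /kmin : t <= rho * 2 * 2 ^+ k by move: hlt; rewrite exprSr; lra.
by rewrite ltnn.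
Qed.

Definition near_pow (c rho : R) (x : 'rV[R]_d) : R :=
  if enorm x <= rho then enorm x `^ c else 0.

Definition far_pow (c rho : R) (x : 'rV[R]_d) : R :=
  if rho < enorm x then enorm x `^ c else 0.

Lemma near_pow_ge0 c rho x : 0 <= near_pow c rho x.
Proof. by rewrite /near_pow; case: ifP => // _; exact: powR_ge0. Qed.

Lemma far_pow_ge0 c rho x : 0 <= far_pow c rho x.
Proof. by rewrite /far_pow; case: ifP => // _; exact: powR_ge0. Qed.

Lemma measurable_near_pow c rho {dT} {T : measurableType dT} (f : T -> 'rV[R]_d) :
  (forall i, measurable_fun setT (fun t => f t ord0 i)) ->
  measurable_fun setT (fun t => near_pow c rho (f t)).
Proof.
move=> mf; have me := measurable_enorm mf.
apply: measurable_fun_ifT => //; first exact: measurable_fun_ler.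
exact: (measurableT_comp (measurable_powR _)).
Qed.

Lemma measurable_far_pow c rho {dT} {T : measurableType dT} (f : T -> 'rV[R]_d) :
  (forall i, measurable_fun setT (fun t => f t ord0 i)) ->
  measurable_fun setT (fun t => far_pow c rho (f t)).
Proof.
move=> mf; have me := measurable_enorm mf.
apply: measurable_fun_ifT => //; first exact: measurable_fun_ltr.
exact: (measurableT_comp (measurable_powR _)).
Qed.

Variable mu : {measure set 'rV[R]_d -> \bar R}.
Hypothesis mu_leb : is_lebesgue_Rd mu.

(** The volume factor turns the exponent c into c + d, so the series is geometric with ratio r^(c +
    d). Taking r = 1/2 handles a singularity with c > -d, and r = 2 handles infinity with c < -d. *)
Lemma shell_series (M tau r c : R) : 0 <= M -> 0 < tau -> 0 < r ->
  r `^ (c + d%:R) < 1 ->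
  (\sum_(k <oo) (M * (tau * r ^+ k) `^ c * (2 * (tau * r ^+ k)) ^+ d)%:E <=
    (M * 2 ^+ d * tau `^ (c + d%:R) / (1 - r `^ (c + d%:R)))%:E)%E.
Proof.
move=> M0 tau0 r0 z1; set a := M * _ * _; set z := r `^ _.
have z0 : 0 < z by exact: powR_gt0.
have E k : M * (tau * r ^+ k) `^ c * (2 * (tau * r ^+ k)) ^+ d = a * z ^+ k.
  have t0 : 0 < tau * r ^+ k by rewrite mulr_gt0 ?exprn_gt0.
  rewrite exprMn -(powR_mulrn d (ltW t0)) mulrACA mulrA -mulrA -powRD; last first.
    by apply/implyP => _; rewrite gt_eqF.
  rewrite powRM ?exprn_ge0 ?ltW// -[r ^+ k]powR_mulrn ?(ltW r0)// powRAC.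
  by rewrite powR_mulrn ?(ltW z0)// mulrA.
have a0 : 0 <= a by rewrite !mulr_ge0 ?exprn_ge0 ?powR_ge0.
apply: lime_le.
  by apply: is_cvg_nneseries => n _ _; rewrite lee_fin E mulr_ge0// exprn_ge0// ltW.
apply: nearW => n; rewrite sumEFin lee_fin (eq_bigr (geometric a z)).
  by apply: (@geometric_le_lim R n a z) => //; rewrite gtr0_norm.
by move=> k _; exact: E.
Qed.

(** The shells are centred at z and their volumes do not depend on z, so one [K] serves all z. This
    uniformity is what the kernel in x - y requires. *)
Lemma integral_near_pow (c rho : R) : - d%:R < c -> 0 < rho ->
  exists K : R,
    forall z, (\int[mu]_x (near_pow c rho (z - x))%:E <= K%:E)%E.
Proof.
move=> cd rho0; pose M := 1 + 2 `^ (- c).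
have M0 : 0 <= M by rewrite addr_ge0 ?powR_ge0.
have h0 : 0 < 2^-1 :> R by rewrite invr_gt0.
have z1 : 2^-1 `^ (c + d%:R) < 1 :> R.
  by rewrite powRV//; apply: powR_lt1; lra.
eexists => z; apply: le_trans (shell_series M0 rho0 h0 z1).
apply: (@integral_shells R d mu mu_leb z _
  (fun k => M * (rho * 2^-1 ^+ k) `^ c) (fun k => rho * 2^-1 ^+ k)).
- apply: measurable_near_pow => i.
  under eq_fun do rewrite !mxE.
  by apply: measurable_funB => //; exact: measurable_coord.
- by move=> x; exact: near_pow_ge0.
- by move=> k; rewrite mulr_ge0// powR_ge0.
- by move=> k; rewrite mulr_ge0 ?(ltW rho0)// exprn_ge0// ltW.
- move=> x; rewrite /near_pow; case: ifP => [xrho|_]; last by rewrite ltxx.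
  have := enorm_ge0 (z - x); rewrite le_eqVlt => /predU1P[<-|x0 _].
    (* At the centre the power is 0 by convention unless c = 0, when it is 1 and the shell k = 0
       suffices. *)
    have [->|c0] := eqVneq c 0; last by rewrite powR0// ltxx.
    move=> _; exists 0%N; split; last by rewrite expr0 mulr1 ltW.
    by rewrite !powRr0 mulr1 lerDl powR_ge0.
  have [k /andP[k1 k2]] := dyadic_near x0 xrho.
  exists k; split=> //; apply: powR_half_annulus; rewrite ?k1//.
  by rewrite mulr_gt0// exprn_gt0.
Qed.

Lemma integral_far_pow (c rho : R) : c < - d%:R -> 0 < rho ->
  (\int[mu]_x (far_pow c rho x)%:E < +oo)%E.
Proof.
move=> cd rho0; pose M := 1 + 2 `^ (- c).
have M0 : 0 <= M by rewrite addr_ge0 ?powR_ge0.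
have h0 : 0 < rho * 2 by rewrite mulr_gt0.
have z1 : 2 `^ (c + d%:R) < 1 :> R by apply: powR_lt1; lra.
have r0 : 0 < 2 :> R by [].
apply: le_lt_trans (ltry _); last apply: le_trans (shell_series M0 h0 r0 z1).
apply: (@integral_shells R d mu mu_leb 0 _
  (fun k => M * (rho * 2 * 2 ^+ k) `^ c) (fun k => rho * 2 * 2 ^+ k)).
- by apply: measurable_far_pow => i; exact: measurable_coord.
- by move=> x; exact: far_pow_ge0.
- by move=> k; rewrite mulr_ge0// powR_ge0.
- by move=> k; rewrite mulr_ge0 ?(ltW h0)// exprn_ge0// ltW.
- move=> x; rewrite /far_pow sub0r enormN; case: ifP; last by rewrite ltxx.
  move=> xrho _; have [k /andP[k1 k2]] := dyadic_far rho0 xrho.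
  exists k; split=> //; apply: powR_half_annulus; rewrite ?k1//.
  by rewrite mulr_gt0// exprn_gt0.
Qed.

End power_weights.

(** * Boundedness and Lipschitz estimates for C^1_c functions *)

Section C1c_functions.
Context {R : realType} {d : nat}.
Implicit Types (x y : 'rV[R]_d) (f : 'rV[R]_d -> R).

Lemma continuous_bounded_ball f (rho : R) : continuous f ->
  exists M : R, 0 <= M /\ forall x, `|x| <= rho -> `|f x| <= M.
Proof.
move=> cf.
have cK : compact [set x : 'rV[R]_d | `|x| <= rho].
  apply: bounded_closed_compact.
    exists rho; split; first exact: num_real.
    by move=> M /ltW rM x /=; move/le_trans; exact.
  rewrite (_ : [set _ | _] = Num.norm @^-1` [set t : R | t <= rho])//.
  apply: preimage_closed => [x _|]; [exact: norm_continuous|exact: closed_le].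
have : compact (f @` [set x : 'rV[R]_d | `|x| <= rho]).
  by apply: continuous_compact => //; exact: continuous_subspaceT.
move=> /compact_bounded [M [_ hM]].
exists (`|M| + 1); split; first by rewrite addr_ge0.
move=> x xr; apply: hM; first by rewrite ltr_pwDr// ler_norm.
by exists x.
Qed.

Lemma diff_segment f x y (t : R) : differentiable f (y + t *: (x - y)) ->
  is_derive t 1 (fun t : R => f (y + t *: (x - y)))
    ('d f (y + t *: (x - y)) (x - y)).
Proof.
move=> df; pose h := cst y + (fun t : R => t *: (x - y)) : R -> 'rV[R]_d.
have dh : is_diff t h (0 + (fun s : R => s *: (x - y))) by exact: is_diffD.
have dfh : is_diff t (f \o h) ('d f (h t) \o (0 + (fun s : R => s *: (x - y)))).
  by apply: is_diff_comp; exact: differentiableP.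
case: dfh => dfh1 dfh2.
split; first exact: diff_derivable.
by rewrite deriveE// dfh2/= !fctE add0r scale1r.
Qed.

Lemma C1c_lipschitz f (rho : R) : C1c f -> exists L : R, 0 <= L /\
  forall x y, enorm x <= rho -> enorm y <= rho ->
  `|f x - f y| <= L * enorm (x - y).
Proof.
move=> [df [cdf _]].
(* Points y + t (x - y) of the segment have max norm at most |y| + |x| + |y|, hence the radius 3
   rho. *)
have /choice[M MP] : forall i : 'I_d, exists M : R, 0 <= M /\
    forall x, `|x| <= rho + (rho + rho) -> `|'d f x (delta_mx ord0 i)| <= M.
  by move=> i; exact: (continuous_bounded_ball _ (cdf _)).
exists (\sum_i M i); split; first by apply: sumr_ge0 => i _; case: (MP i).
move=> x y xr yr.
pose g t := f (y + t *: (x - y)).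
have cg : {within `[0, 1], continuous g}.
  apply: derivable_within_continuous => t _.
  by case: (@diff_segment f x y t (df _)).
have [t] := MVT_segment ler01 (fun t _ => @diff_segment f x y t (df _)) cg.
rewrite in_itv/= => /andP[t0 t1].
rewrite /g scale1r scale0r addr0 subr0 mulr1 subrKC => ->.
set z := y + _.
have zr : `|z| <= rho + (rho + rho).
  have nx : `|x| <= rho by exact: le_trans (norm_le_enorm _) xr.
  have ny : `|y| <= rho by exact: le_trans (norm_le_enorm _) yr.
  rewrite (le_trans (ler_normD _ _))// lerD// normrZ ger0_norm//.
  rewrite (le_trans (y := `|x - y|)) ?ler_piMl//.
  by rewrite (le_trans (ler_normB _ _))// lerD.
(* Expanding the direction x - y in the standard basis reduces the differential to the partial
   derivatives. *)
rewrite [X in 'd f z X]row_sum_delta linear_sum/= (le_trans (ler_norm_sum _ _ _))//.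
rewrite mulr_suml ler_sum// => i _; rewrite linearZ/= normrM mulrC ler_pM//.
  by case: (MP i) => _; exact.
exact: coord_le_enorm.
Qed.

Lemma C1c_measurable f : C1c f -> measurable_fun setT f.
Proof.
move=> [df _]; apply: continuous_rV_measurable => x.
exact/differentiable_continuous/df.
Qed.

Lemma C1c_bounded f : C1c f -> exists M : R, 0 <= M /\ forall x, `|f x| <= M.
Proof.
move=> [df [_ [r fr]]].
have [|M [M0 MP]] := @continuous_bounded_ball f r.
  by move=> x; exact/differentiable_continuous/df.
exists M; split=> // x; have [xr|xr] := leP (enorm x) r.
  by apply: MP; exact: le_trans (norm_le_enorm _) xr.
by rewrite fr// normr0.
Qed.

End C1c_functions.

(** * Tonelli's theorem for a sigma-finite measure *)

Section tonelli.
Context {dT : measure_display} {T : measurableType dT} {R : realType}.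
Variable mu : {measure set T -> \bar R}.
Hypothesis mu_sf : sigma_finite setT mu.

Lemma sigma_finite_measureE :
  exists m : {sigma_finite_measure set T -> \bar R}, m = mu :> (set T -> \bar R).
Proof.
pose m : {sigma_finite_measure set T -> \bar R} :=
  HB.pack (Measure.sort mu)
    (isSFinite.Build dT T R mu (sfinite_measure_sigma_finite mu_sf))
    (isSigmaFinite.Build dT T R mu mu_sf).
by exists m.
Qed.

(** The product measure is exposed only through its two iterated integrals. It turns the Gagliardo
    double integral into a single one, where additivity and domination apply directly. *)
Lemma tonelli_square : exists nu : {measure set (T * T)%type -> \bar R},
  forall f : T * T -> \bar R, measurable_fun setT f -> (forall z, 0 <= f z)%E ->
  (\int[nu]_z f z = \int[mu]_x \int[mu]_y f (x, y))%E /\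
  (\int[nu]_z f z = \int[mu]_y \int[mu]_x f (x, y))%E.
Proof.
have [m <-] := sigma_finite_measureE.
exists (m \x m)%E => f mf f0.
by split; [exact: fubini_tonelli1|exact: fubini_tonelli2].
Qed.

Lemma measurable_integral_snd (f : T * T -> \bar R) :
  measurable_fun setT f -> (forall z, 0 <= f z)%E ->
  measurable_fun setT (fun x => \int[mu]_y f (x, y))%E.
Proof.
have [m <-] := sigma_finite_measureE.
exact: measurable_fun_fubini_tonelli_F.
Qed.

Lemma iterated_integral_lty (g : T -> R) (k : T * T -> R) (K : R) :
  measurable_fun setT g -> measurable_fun setT k ->
  (forall x, 0 <= g x) -> (forall z, 0 <= k z) ->
  (\int[mu]_x (g x)%:E < +oo)%E ->
  (forall x, \int[mu]_y (k (x, y))%:E <= K%:E)%E ->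
  (\int[mu]_x \int[mu]_y (g x * k (x, y))%:E < +oo)%E.
Proof.
move=> mg mk g0 k0 ig ik.
have mks x : measurable_fun setT (fun y => (k (x, y))%:E).
  by apply/measurable_EFinP; apply: (measurableT_comp mk); exact: pair1_measurable.
have E x : (\int[mu]_y (g x * k (x, y))%:E = (g x)%:E * \int[mu]_y (k (x, y))%:E)%E.
  rewrite -ge0_integralZl//; last by rewrite lee_fin.
  by move=> y _; rewrite lee_fin.
(* The inner integral is at most K, and |K| is a nonnegative factor that can leave the outer
   integral. *)
apply: (@le_lt_trans _ _ (\int[mu]_x (`|K|%:E * (g x)%:E))%E).
  apply: ge0_le_integral => //.
  - by move=> x _; apply: integral_ge0 => y _; rewrite lee_fin mulr_ge0.
  - apply: (measurable_integral_snd (f := fun z => (g z.1 * k z)%:E)).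
      apply/measurable_EFinP; apply: measurable_funM => //.
      by apply: (measurableT_comp mg); exact: measurable_fst.
    by move=> z; rewrite lee_fin mulr_ge0.
  - by apply: measurable_funeM; exact/measurable_EFinP.
  - move=> x _; rewrite E muleC lee_wpmul2r ?lee_fin//.
    by rewrite (le_trans (ik x))// lee_fin ler_norm.
rewrite ge0_integralZl//; [|exact/measurable_EFinP|by move=> x _; rewrite lee_fin].
by apply: lte_mul_pinfty => //; rewrite lee_fin.
Qed.

End tonelli.

(** * Finiteness of the Gagliardo seminorm *)

Section gagliardo_finite.
Context {R : realType} {d : nat}.
Implicit Types (x y : 'rV[R]_d) (u f : 'rV[R]_d -> R).

(** The letters A, D, X, Y stand for |f(x) - f(y)|, |x - y|, |x|, |y|. The Lipschitz bound gives A^p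
    <= L^p D^p, and the weight with nonnegative exponent is at most rho^b2. *)
Lemma kernel_near (A D X Y L rho p q b1 b2 : R) : 0 < p -> q != 0 ->
  0 <= A -> A <= L * D -> 0 <= L -> 0 <= D -> 0 <= X -> 0 <= Y <= rho -> 0 <= b2 ->
  A `^ p / D `^ q * X `^ b1 * Y `^ b2 <= L `^ p * rho `^ b2 * (X `^ b1 * D `^ (p - q)).
Proof.
move=> p0 q0 A0 AD L0 D0 X0 /andP[Y0 Yr] b20.
move: D0; rewrite le_eqVlt => /predU1P[<-|D0].
  (* On the diagonal the quotient is 0, because the inverse of 0 is 0. *)
  by rewrite (powR0 q0) invr0 mulr0 !mul0r !mulr_ge0// powR_ge0.
rewrite powRB; last by apply/implyP => _; rewrite gt_eqF.
rewrite [leRHS](_ : _ = L `^ p * D `^ p / D `^ q * X `^ b1 * rho `^ b2); last by ring.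
rewrite ler_pM ?mulr_ge0 ?invr_ge0 ?powR_ge0//; last first.
  by rewrite ge0_ler_powR ?nnegrE// (le_trans Y0).
rewrite ler_wpM2r ?powR_ge0// ler_wpM2r ?invr_ge0 ?powR_ge0//.
by rewrite -powRM ?(ltW D0)// ge0_ler_powR ?nnegrE ?mulr_ge0 ?(ltW p0) ?(ltW D0).
Qed.

(** From D >= Y/2 follows D^-q <= 2^q Y^-q, while the numerator is at most M^p. *)
Lemma kernel_far (A D X Y M p q b1 b2 : R) : 0 < p -> 0 < q ->
  0 <= A -> A <= M -> 0 < Y -> Y / 2 <= D ->
  A `^ p / D `^ q * X `^ b1 * Y `^ b2 <= M `^ p * 2 `^ q * (X `^ b1 * Y `^ (b2 - q)).
Proof.
move=> p0 q0 A0 AM Y0 YD; have M0 : 0 <= M by lra.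
have D0 : 0 < D by lra.
rewrite powRB; last by apply/implyP => _; rewrite gt_eqF.
rewrite [leRHS](_ : _ = M `^ p * (2 `^ q / Y `^ q) * X `^ b1 * Y `^ b2); last by ring.
rewrite ler_wpM2r ?powR_ge0// ler_wpM2r ?powR_ge0//.
rewrite ler_pM ?invr_ge0 ?powR_ge0//; first by rewrite ge0_ler_powR ?nnegrE// ltW.
rewrite -invf_div lef_pV2 ?posrE ?divr_gt0 ?powR_gt0//.
rewrite -powRN -powRV// -powRM ?(ltW Y0)// ge0_ler_powR ?nnegrE//; lra.
Qed.

Variables (mu : {measure set 'rV[R]_d -> \bar R}) (s p a1 a2 : R).

Definition gagliardo_kernel u (z : 'rV[R]_d * 'rV[R]_d) : R :=
  (`|u z.1 - u z.2| `^ p / enorm (z.1 - z.2) `^ (d%:R + s * p))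
    * enorm z.1 `^ (a1 * p) * enorm z.2 `^ (a2 * p).

Lemma gagliardo_kernel_ge0 u z : 0 <= gagliardo_kernel u z.
Proof. by rewrite !mulr_ge0// ?invr_ge0 powR_ge0. Qed.

Lemma measurable_fst_coord i :
  measurable_fun setT (fun z : 'rV[R]_d * 'rV[R]_d => z.1 ord0 i).
Proof. by apply: (measurableT_comp (measurable_coord i)); exact: measurable_fst. Qed.

Lemma measurable_snd_coord i :
  measurable_fun setT (fun z : 'rV[R]_d * 'rV[R]_d => z.2 ord0 i).
Proof. by apply: (measurableT_comp (measurable_coord i)); exact: measurable_snd. Qed.

Lemma measurable_sub_coord i :
  measurable_fun setT (fun z : 'rV[R]_d * 'rV[R]_d => (z.1 - z.2) ord0 i).
Proof.
under eq_fun do rewrite !mxE.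
apply: measurable_funB; [exact: measurable_fst_coord|exact: measurable_snd_coord].
Qed.

Lemma measurable_gagliardo_kernel u : measurable_fun setT u ->
  measurable_fun setT (gagliardo_kernel u).
Proof.
move=> mu_; have mpow c (h : 'rV[R]_d * 'rV[R]_d -> R) : measurable_fun setT h ->
    measurable_fun setT (fun z => h z `^ c).
  by move=> mh; exact: (measurableT_comp (measurable_powR _)).
apply: measurable_funM; last first.
  by apply: mpow; apply: measurable_enorm => i; exact: measurable_snd_coord.
apply: measurable_funM; last first.
  by apply: mpow; apply: measurable_enorm => i; exact: measurable_fst_coord.
apply: measurable_funM.
  apply: mpow; apply: measurableT_comp => //; apply: measurable_funB.
    by apply: (measurableT_comp mu_); exact: measurable_fst.
  by apply: (measurableT_comp mu_); exact: measurable_snd.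
under eq_fun do rewrite -powRN.
by apply: mpow; apply: measurable_enorm => i; exact: measurable_sub_coord.
Qed.

Hypotheses (p1 : 1 < p) (s01 : 0 < s < 1).
Hypotheses (a1p : - d%:R < a1 * p < s * p) (a2p : - d%:R < a2 * p < s * p).
Hypothesis (ap : 0 <= (a1 + a2) * p).

Local Notation q := (d%:R + s * p).
Local Notation e := (p - q).

(** The first two terms serve pairs inside the ball, according to which weight can be bounded; the
    last two serve pairs with exactly one point inside. *)
Definition kernel_majorant (C1 C2 rho : R) (z : 'rV[R]_d * 'rV[R]_d) : R :=
  C1 * (near_pow (a1 * p) rho z.1 * near_pow e (2 * rho) (z.1 - z.2)) +
  C1 * (near_pow (a2 * p) rho z.2 * near_pow e (2 * rho) (z.1 - z.2)) +
  C2 * (near_pow (a1 * p) rho z.1 * far_pow (a2 * p - q) rho z.2) +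
  C2 * (far_pow (a1 * p - q) rho z.1 * near_pow (a2 * p) rho z.2).

Lemma gagliardo_kernel_C1c_le f : C1c f -> exists C1 C2 rho : R,
  [/\ 0 <= C1, 0 <= C2, 0 < rho &
      forall z, gagliardo_kernel f z <= kernel_majorant C1 C2 rho z].
Proof.
move=> fC; have [M [M0 fM]] := C1c_bounded fC.
have [_ [_ [r0 fr0]]] := fC.
have [r [rpos fr]] : exists r : R, 0 < r /\ forall x, r < enorm x -> f x = 0.
  exists (`|r0| + 1); split; first by rewrite ltr_wpDl.
  by move=> x h; apply: fr0; apply: le_lt_trans h; rewrite ler_wpDr// ler_norm.
have [L [L0 fL]] := C1c_lipschitz (2 * r) fC.
have p0 : 0 < p := lt_trans ltr01 p1.
have q0 : 0 < q by rewrite ltr_wpDl// mulr_gt0//; case/andP: s01.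
(* With rho = 2r, a point of norm at most r and a point y with |y| > rho are at distance at least
   |y|/2. *)
set rho := 2 * r in fL *; have rho0 : 0 < rho by rewrite mulr_gt0.
pose C1 := L `^ p * rho `^ (a1 * p) + L `^ p * rho `^ (a2 * p).
pose C2 := (2 * M) `^ p * 2 `^ q.
have C10 : 0 <= C1 by rewrite addr_ge0// mulr_ge0// powR_ge0.
have C20 : 0 <= C2 by rewrite mulr_ge0// powR_ge0.
exists C1, C2, rho; split=> // -[x y].
have fxyM : `|f x - f y| <= 2 * M.
  by rewrite (le_trans (ler_normB _ _))// mulr_natl mulr2n lerD.
have near0 c h (v : 'rV[R]_d) := near_pow_ge0 c h v.
have far0 c h (v : 'rV[R]_d) := far_pow_ge0 c h v.
(* This disposes of the pairs at which f vanishes twice. *)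
have kz : f x = f y -> gagliardo_kernel f (x, y) <= kernel_majorant C1 C2 rho (x, y).
  move=> fxy; rewrite /gagliardo_kernel/= fxy subrr normr0 powR0 ?gt_eqF// !mul0r.
  by rewrite /kernel_majorant !addr_ge0// mulr_ge0// mulr_ge0.
have majP t :
    t <= C1 * (near_pow (a1 * p) rho x * near_pow e (2 * rho) (x - y)) \/
    t <= C1 * (near_pow (a2 * p) rho y * near_pow e (2 * rho) (x - y)) \/
    t <= C2 * (near_pow (a1 * p) rho x * far_pow (a2 * p - q) rho y) \/
    t <= C2 * (far_pow (a1 * p - q) rho x * near_pow (a2 * p) rho y) ->
    t <= kernel_majorant C1 C2 rho (x, y).
  have add4 (t1 t2 t3 t4 : R) : 0 <= t1 -> 0 <= t2 -> 0 <= t3 -> 0 <= t4 ->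
      t <= t1 \/ t <= t2 \/ t <= t3 \/ t <= t4 -> t <= t1 + t2 + t3 + t4.
    by move=> ? ? ? ?; case=> [?|[?|[?|?]]]; lra.
  by apply: add4; (rewrite mulr_ge0//; exact: mulr_ge0).
have [xr|xr] := leP (enorm x) rho; have [yr|yr] := leP (enorm y) rho.
- apply: majP.
  have xyr : enorm (x - y) <= 2 * rho.
    by rewrite (le_trans (ler_enormB _ _))// mulr_natl mulr2n lerD.
  rewrite /near_pow xr yr xyr.
  (* Since the exponents have nonnegative sum, one of them is nonnegative and its weight is bounded;
     the other weight stays in the majorant. *)
  have [a20|a20] := leP 0 (a2 * p); [left|right; left].
    apply: (le_trans (@kernel_near _ _ _ _ L rho p q _ _ _ _ _ _ _ _ _ _ _)) => //.
    - by rewrite gt_eqF.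
    - exact: fL.
    - exact: enorm_ge0.
    - exact: enorm_ge0.
    - by rewrite enorm_ge0.
    - by rewrite ler_wpM2r ?mulr_ge0 ?powR_ge0// lerDr mulr_ge0// powR_ge0.
  rewrite /gagliardo_kernel mulrAC/=.
  apply: (le_trans (@kernel_near _ _ _ _ L rho p q _ _ _ _ _ _ _ _ _ _ _)) => //.
  - by rewrite gt_eqF.
  - exact: fL.
  - exact: enorm_ge0.
  - exact: enorm_ge0.
  - by rewrite enorm_ge0.
  - by move: ap; rewrite mulrDl; lra.
  - by rewrite ler_wpM2r ?mulr_ge0 ?powR_ge0// lerDl mulr_ge0// powR_ge0.
(* If |x| > r as well, both values of f are 0; otherwise x and y are far apart. *)
- have [xr'|xr'] := leP (enorm x) r; last first.
    by apply: kz; rewrite !fr//; lra.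
  apply: majP; right; right; left.
  rewrite /near_pow /far_pow xr yr.
  apply: kernel_far => //; first lra.
  have := ler_enormD (y - x) x; rewrite subrK -(enormB x) => h.
  by rewrite /rho in yr; lra.
- have [yr'|yr'] := leP (enorm y) r; last first.
    by apply: kz; rewrite !fr//; lra.
  apply: majP; right; right; right.
  rewrite /near_pow /far_pow xr yr /gagliardo_kernel mulrAC/= (mulrC (enorm x `^ _)).
  apply: kernel_far => //; first lra.
  have := ler_enormD (x - y) y; rewrite subrK => h.
  by rewrite /rho in xr; lra.
- by apply: kz; rewrite !fr//; move: xr yr; rewrite /rho; lra.
Qed.

Hypothesis mu_leb : is_lebesgue_Rd mu.

Lemma integral_near_pow_lty c rho : - d%:R < c -> 0 < rho ->
  (\int[mu]_x (near_pow c rho x)%:E < +oo)%E.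
Proof.
move=> cd rho0; have [K hK] := integral_near_pow mu_leb cd rho0.
apply: le_lt_trans (ltry K); apply: le_trans (hK 0).
by under [leRHS]eq_integral do rewrite /near_pow sub0r enormN.
Qed.

(** For the near terms, p - q > -d because s < 1, so the integral in x - y is uniformly bounded and
    a locally integrable weight remains. The far terms are products of one-variable functions, with
    a_i p - q < -d because a_i p < sp. *)
Lemma kernel_majorant_integrable (nu : {measure set ('rV[R]_d * 'rV[R]_d) -> \bar R})
    (C1 C2 rho : R) :
  (forall f : 'rV[R]_d * 'rV[R]_d -> \bar R, measurable_fun setT f ->
    (forall z, 0 <= f z)%E ->
    (\int[nu]_z f z = \int[mu]_x \int[mu]_y f (x, y))%E /\
    (\int[nu]_z f z = \int[mu]_y \int[mu]_x f (x, y))%E) ->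
  0 <= C1 -> 0 <= C2 -> 0 < rho ->
  nu.-integrable setT (fun z => (kernel_majorant C1 C2 rho z)%:E).
Proof.
move=> nuE C10 C20 rho0.
have mu_sf := lebesgue_sigma_finite mu_leb.
have s0 : 0 < s * p by rewrite mulr_gt0//; [case/andP: s01|exact: lt_trans p1].
have ed : - d%:R < e.
  have : 0 < p * (1 - s).
    by rewrite mulr_gt0 ?(lt_trans ltr01 p1)// subr_gt0; case/andP: s01.
  by lra.
have mN1 c h := measurable_near_pow c h measurable_fst_coord.
have mN2 c h := measurable_near_pow c h measurable_snd_coord.
have mF1 c h := measurable_far_pow c h measurable_fst_coord.
have mF2 c h := measurable_far_pow c h measurable_snd_coord.
have mNS c h := measurable_near_pow c h measurable_sub_coord.
have mN c h : measurable_fun setT (@near_pow R d c h).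
  exact: measurable_near_pow measurable_coord.
have mF c h : measurable_fun setT (@far_pow R d c h).
  exact: measurable_far_pow measurable_coord.
have near0 c h (v : 'rV[R]_d) := near_pow_ge0 c h v.
have far0 c h (v : 'rV[R]_d) := far_pow_ge0 c h v.
have rho20 : 0 < 2 * rho by rewrite mulr_gt0.
case/andP: a1p => a1d a1s; case/andP: a2p => a2d a2s.
have [K hK] := integral_near_pow mu_leb ed rho20.
have iN1 := integral_near_pow_lty a1d rho0.
have iN2 := integral_near_pow_lty a2d rho0.
have iF1 : (\int[mu]_x (far_pow (a1 * p - q) rho x)%:E < +oo)%E.
  by apply: integral_far_pow => //; lra.
have iF2 : (\int[mu]_x (far_pow (a2 * p - q) rho x)%:E < +oo)%E.
  by apply: integral_far_pow => //; lra.
pose t1 (z : 'rV[R]_d * 'rV[R]_d) : R :=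
  near_pow (a1 * p) rho z.1 * near_pow e (2 * rho) (z.1 - z.2).
pose t2 (z : 'rV[R]_d * 'rV[R]_d) : R :=
  near_pow (a2 * p) rho z.2 * near_pow e (2 * rho) (z.1 - z.2).
pose t3 (z : 'rV[R]_d * 'rV[R]_d) : R :=
  near_pow (a1 * p) rho z.1 * far_pow (a2 * p - q) rho z.2.
pose t4 (z : 'rV[R]_d * 'rV[R]_d) : R :=
  far_pow (a1 * p - q) rho z.1 * near_pow (a2 * p) rho z.2.
have mt1 : measurable_fun setT t1 by exact: measurable_funM.
have mt2 : measurable_fun setT t2 by exact: measurable_funM.
have mt3 : measurable_fun setT t3 by exact: measurable_funM.
have mt4 : measurable_fun setT t4 by exact: measurable_funM.
have t10 z : 0 <= t1 z by rewrite mulr_ge0.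
have t20 z : 0 <= t2 z by rewrite mulr_ge0.
have t30 z : 0 <= t3 z by rewrite mulr_ge0.
have t40 z : 0 <= t4 z by rewrite mulr_ge0.
have fin_le (i : \bar R) : (i < +oo)%E -> (0 <= i)%E -> (i <= (fine i)%:E)%E.
  by move=> iy i0; rewrite fineK// ge0_fin_numE.
have I1 : (\int[nu]_z (t1 z)%:E < +oo)%E.
  rewrite (nuE (EFin \o t1) _ _).1//=; [|exact/measurable_EFinP].
  exact: (iterated_integral_lty mu_sf (mN _ _) (mNS _ _) _ _ iN1 hK).
have I2 : (\int[nu]_z (t2 z)%:E < +oo)%E.
  rewrite (nuE (EFin \o t2) _ _).2//=; [|exact/measurable_EFinP].
  (* Here the weight is in y, so x is integrated first, using the symmetry of |x - y|. *)
  rewrite [ltLHS](_ : _ = \int[mu]_y \int[mu]_x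
      (near_pow (a2 * p) rho y * near_pow e (2 * rho) (y - x))%:E)%E.
    exact: (iterated_integral_lty mu_sf (mN _ _) (mNS _ _) _ _ iN2 hK).
  apply: eq_integral => y _; apply: eq_integral => x _.
  by rewrite /t2 /= [near_pow e _ (x - y)]/near_pow enormB.
have I3 : (\int[nu]_z (t3 z)%:E < +oo)%E.
  rewrite (nuE (EFin \o t3) _ _).1//=; [|exact/measurable_EFinP].
  apply: (iterated_integral_lty (k := fun z => far_pow (a2 * p - q) rho z.2)
    mu_sf (mN _ _) (mF2 _ _) _ _ iN1) => //= x.
  by apply: fin_le => //; apply: integral_ge0 => y _; rewrite lee_fin.
have I4 : (\int[nu]_z (t4 z)%:E < +oo)%E.
  rewrite (nuE (EFin \o t4) _ _).1//=; [|exact/measurable_EFinP].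
  apply: (iterated_integral_lty (k := fun z => near_pow (a2 * p) rho z.2)
    mu_sf (mF _ _) (mN2 _ _) _ _ iF1) => //= x.
  by apply: fin_le => //; apply: integral_ge0 => y _; rewrite lee_fin.
have int (t : 'rV[R]_d * 'rV[R]_d -> R) (C : R) :
    measurable_fun setT t -> (forall z, 0 <= t z) ->
    (\int[nu]_z (t z)%:E < +oo)%E -> nu.-integrable setT (fun z => (C * t z)%:E).
  move=> mt t0 it; apply: (integrableZl measurableT C (f := EFin \o t)).
  apply/integrableP; split; first exact/measurable_EFinP.
  by under eq_integral do rewrite /= ger0_norm//.
have D4 := integrableD measurableT (integrableD measurableT
  (integrableD measurableT (int _ C1 mt1 t10 I1) (int _ C1 mt2 t20 I2))
  (int _ C2 mt3 t30 I3)) (int _ C2 mt4 t40 I4).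
exact: D4.
Qed.

Lemma powR_normD_le (a b : R) :
  `|a + b| `^ p <= 2 `^ p * `|a| `^ p + 2 `^ p * `|b| `^ p.
Proof.
have p0 : 0 <= p := ltW (lt_trans ltr01 p1).
rewrite -!powRM//.
(* The larger term dominates: |a + b| <= 2 |b|. *)
wlog ab : a b / `|a| <= `|b|.
  move=> h; have [ab|/ltW ba] := leP `|a| `|b|; first exact: h.
  by rewrite addrC [leRHS]addrC; exact: h.
rewrite (le_trans (y := (2 * `|b|) `^ p)) ?lerDr ?powR_ge0//.
rewrite ge0_ler_powR ?nnegrE ?mulr_ge0// (le_trans (ler_normD _ _))//.
by rewrite mulr_natl mulr2n lerD2r.
Qed.

Lemma gagliardo_kernel_split u f z : gagliardo_kernel u z <=
  2 `^ p * gagliardo_kernel (u \- f) z + 2 `^ p * gagliardo_kernel f z.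
Proof.
rewrite /gagliardo_kernel !mulrA -!mulrDl /=.
rewrite ler_wpM2r ?powR_ge0// ler_wpM2r ?powR_ge0// ler_wpM2r ?invr_ge0 ?powR_ge0//.
rewrite (_ : u z.1 - u z.2 = (u z.1 - f z.1 - (u z.2 - f z.2)) + (f z.1 - f z.2)).
  exact: powR_normD_le.
by ring.
Qed.

(** A single approximant suffices: u = (u - phi_n) + phi_n for one n at which the first seminorm is
    finite, the second being finite by the majorant. *)
Lemma Wspa_gagliardo_lty u : Wspa mu s p a1 a2 u ->
  (gagliardo mu s p a1 a2 u < +oo)%E.
Proof.
move=> [mu_ [phi [phiC cvg0]]].
have [nu nuE] := tonelli_square (lebesgue_sigma_finite mu_leb).
have mk f : measurable_fun setT f ->
    measurable_fun setT (fun z => (gagliardo_kernel f z)%:E).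
  by move=> mf; apply/measurable_EFinP; exact: measurable_gagliardo_kernel.
have gE f : measurable_fun setT f ->
    gagliardo mu s p a1 a2 f = (\int[nu]_z (gagliardo_kernel f z)%:E)%E.
  move=> mf; rewrite (nuE (fun z => (gagliardo_kernel f z)%:E) _ _).1//.
    exact: mk.
  by move=> z; rewrite lee_fin gagliardo_kernel_ge0.
have [n wn] : exists n, (gagliardo mu s p a1 a2 (fun x => u x - phi n x)%R < +oo)%E.
  (* Convergence to 0 in the extended reals makes the terms eventually finite. *)
  have /fine_cvgP[[N _ /(_ N (leqnn N)) /= hN] _] := cvg0.
  exists N; move: hN; rewrite fin_numD => /andP[_].
  by rewrite fin_numE ltey => /andP[].
have mphi := C1c_measurable (phiC n).
have mw : measurable_fun setT (u \- phi n) by exact: measurable_funB.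
have [C1 [C2 [rho [C10 C20 rho0 phi_le]]]] := gagliardo_kernel_C1c_le (phiC n).
have phin : (\int[nu]_z (gagliardo_kernel (phi n) z)%:E < +oo)%E.
  have maj := kernel_majorant_integrable nuE C10 C20 rho0.
  apply: le_lt_trans (integrable_lty measurableT maj).
  apply: ge0_le_integral => //.
  - by move=> z _; rewrite lee_fin gagliardo_kernel_ge0.
  - exact: mk.
  - exact: measurable_int maj.
  - by move=> z _; rewrite lee_fin phi_le.
rewrite gE//.
have p20 : (0 <= (2 `^ p)%:E :> \bar R)%E by rewrite lee_fin powR_ge0.
have k0 f z : (0 <= (gagliardo_kernel f z)%:E)%E.
  by rewrite lee_fin gagliardo_kernel_ge0.
apply: (@le_lt_trans _ _ (\int[nu]_z
  ((2 `^ p)%:E * (gagliardo_kernel (u \- phi n) z)%:E +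
   (2 `^ p)%:E * (gagliardo_kernel (phi n) z)%:E))%E).
  apply: ge0_le_integral => //.
  - exact: mk.
  - by apply: emeasurable_funD; apply: measurable_funeM; exact: mk.
  - by move=> z _; rewrite -!EFinM -EFinD lee_fin gagliardo_kernel_split.
rewrite ge0_integralD//.
- rewrite !ge0_integralZl//; [|exact: mk..].
  by rewrite -gE// lte_add_pinfty// lte_mul_pinfty.
- by move=> z _; rewrite mule_ge0.
- by apply: measurable_funeM; exact: mk.
- by move=> z _; rewrite mule_ge0.
- by apply: measurable_funeM; exact: mk.
Qed.

End gagliardo_finite.

(** * The logarithmic Sobolev inequality *)

Lemma integral_powR_gt0 {dT : measure_display} {T : measurableType dT}
    {R : realType} (mu : {measure set T -> \bar R}) (f : T -> R) (p q : R) :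
  measurable_fun setT f -> p != 0 -> q != 0 ->
  (0 < \int[mu]_x (`|f x| `^ p)%:E)%E -> (0 < \int[mu]_x (`|f x| `^ q)%:E)%E.
Proof.
move=> mf p0 q0 Ip.
have mpow r : measurable_fun setT (fun x => (`|f x| `^ r)%:E).
  apply/measurable_EFinP; apply: (measurableT_comp (measurable_powR _)).
  exact: measurableT_comp.
have abs r : (\int[mu]_x `|(`|f x| `^ r)%:E| = \int[mu]_x (`|f x| `^ r)%:E)%E.
  by apply: eq_integral => x _; rewrite gee0_abs// lee_fin powR_ge0.
rewrite lt_def integral_ge0 ?andbT; last by move=> x _; rewrite lee_fin powR_ge0.
(* A zero integral of |f|^q forces f = 0 almost everywhere, and then the integral of |f|^p is zero
   too. *)
apply/eqP => Iq0; move: Ip; rewrite -abs.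
have : ae_eq mu setT (fun x => (`|f x| `^ q)%:E) (cst 0%E).
  by apply/ae_eq_integral_abs => //; rewrite abs.
move=> fq0; suff /(ae_eq_integral_abs mu measurableT (mpow p)).2 -> : ae_eq mu setT
    (fun x => (`|f x| `^ p)%:E) (cst 0%E) by rewrite ltxx.
apply: filterS fq0 => x /= h xT; have [fx0] := h xT.
by rewrite (powR_eq0_eq0 fx0) powR0.
Qed.

Theorem theorem1p3 (R : realType) (d : nat) (p s a1 a2 : R)
  (mu : {measure set 'rV[R]_d -> \bar R}) (C : R) :
  (1 <= d)%N -> 1 < p -> 0 < s < 1 ->
  - d%:R < a1 * p < s * p -> - d%:R < a2 * p < s * p ->
  0 <= (a1 + a2) * p < s * p -> s * p - (a1 + a2) * p < d%:R ->
  is_lebesgue_Rd mu ->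
  0 < C ->
  (forall u, Wspa mu s p a1 a2 u ->
     ((\int[mu]_x (`|u x| `^ (d%:R * p / (d%:R - s * p + (a1 + a2) * p)))%:E)
        `^ ((d%:R - s * p + (a1 + a2) * p) / (d%:R * p))
      <= (C `^ p^-1)%:E * (gagliardo mu s p a1 a2 u) `^ p^-1)%E) ->
  forall u, Wspa mu s p a1 a2 u -> Lp_pow mu p u = 1%E ->
  (\int[mu]_x (`|u x| `^ p * ln `|u x|)%:E
    <= (d%:R / ((s - (a1 + a2)) * p ^+ 2)
         * ln (C * fine (gagliardo mu s p a1 a2 u)))%:E)%E.
Proof.
move=> d1 p1 s01 a1p a2p /andP[ap0 aps] spd leb C0 sobolev u uW up1.
have mu_ : measurable_fun setT u by case: uW.
have Gfin := Wspa_gagliardo_lty p1 s01 a1p a2p ap0 leb uW.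
have := sobolev u uW.
set m := d%:R - s * p + (a1 + a2) * p; set q := d%:R * p / m.
have m0 : 0 < m by rewrite /m; lra.
have p0 : 0 < p by lra.
have d0 : 0 < d%:R :> R by rewrite ltr0n.
have q0 : 0 < q by rewrite divr_gt0// mulr_gt0.
(* This amounts to m < d, that is, alpha p < sp. *)
have pq : p < q by rewrite /q ltr_pdivlMr// mulrC ltr_pM2r// /m; lra.
rewrite -[m / _]invf_div -/q.
have G0 : (0 <= gagliardo mu s p a1 a2 u)%E.
  apply: integral_ge0 => x _; apply: integral_ge0 => y _.
  by rewrite lee_fin !mulr_ge0 ?invr_ge0 ?powR_ge0.
have Gf : gagliardo mu s p a1 a2 u \is a fin_num by rewrite ge0_fin_numE.
rewrite -[in X in (_ <= X)%E -> _](fineK Gf) poweR_EFin -EFinM.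
have g0 := fine_ge0 G0; move: (fine _) g0 => g g0.
rewrite -powRM ?(ltW C0)// => sob.
have up : (0 < \int[mu]_x (`|u x| `^ p)%:E)%E by rewrite -/(Lp_pow mu p u) up1.
have A0 : (0 < \int[mu]_x (`|u x| `^ q)%:E)%E.
  by apply: integral_powR_gt0 up => //; rewrite gt_eqF.
(* Finiteness comes from the Sobolev inequality, whose right-hand side is now a real number. *)
have Afin : (\int[mu]_x (`|u x| `^ q)%:E < +oo)%E.
  apply: (lty_poweRy (r := q^-1)); first by rewrite invr_eq0 gt_eqF.
  exact: le_lt_trans sob (ltry _).
have AE : (\int[mu]_x (`|u x| `^ q)%:E = (fine (\int[mu]_x (`|u x| `^ q)%:E))%:E)%E.
  by rewrite fineK// ge0_fin_numE// ltW.
move: (fine _) AE => A AE.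
rewrite AE lte_fin in A0; rewrite AE poweR_EFin lee_fin in sob.
apply: (le_trans (entropy_le_ln mu_ p0 pq A0 up1 AE)); rewrite lee_fin.
(* The seminorm cannot vanish, since the L^q norm is positive; the logarithm below is therefore a
   genuine one. *)
have Cg0 : 0 < C * g.
  have : 0 < (C * g) `^ p^-1 by apply: lt_le_trans sob; exact: powR_gt0.
  by apply: gt0_powR; rewrite ?invr_gt0// mulr_ge0// ltW.
have lnA : ln A <= q / p * ln (C * g).
  have : ln (A `^ q^-1) <= ln ((C * g) `^ p^-1) by rewrite ler_ln ?posrE ?powR_gt0.
  by rewrite !ln_powR ler_pdivrMl// mulrA.
have qp0 : 0 < q - p by rewrite subr_gt0.
rewrite ler_pdivrMl// (le_trans lnA)//.
rewrite [leRHS](_ : _ = q / p * ln (C * g))//.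
rewrite mulrA; congr (_ * _).
have sa0 : 0 < s - (a1 + a2).
  by rewrite -(pmulr_lgt0 _ p0) mulrBl subr_gt0.
(* Since q - p = (s - alpha) p^2 / m, both sides equal d / m. *)
by rewrite /q /m; field; rewrite -/m !gt_eqF.
Qed.
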